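(* There is an algorithm which, given a number $k \in \mathbb{N}$ and a family $\mathcal{F}$ of sets over a finite universe of size $n$ in which each pair of distinct sets intersects in at most one element, uses $O(\log n)$ bits of auxiliary space and either correctly determines that the instance is a NO instance of Hitting Set, or outputs an equivalent instance of Hitting Set consisting of a family of at most $k^2$ sets, each with at most $k^2$ elements, in which each pair of distinct sets intersects in at most one element.
   Context: Hitting Set: given a finite universe $U$, a family $\mathcal{F}$ of subsets of $U$ and an integer $k$, decide whether some $H\subseteq U$ with $|H|\le k$ intersects every member of $\mathcal{F}$. Two instances are equivalent if both are YES instances or both are NO instances. Space model: the input is in read-only random-access memory, the output is written to a write-only stream, and only auxiliary read-write memory is counted. *)

(* Defs.v *)
From HB Require Import structures.
From mathcomp Require Import all_boot.

Set Implicit Arguments.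
Unset Strict Implicit.
Unset Printing Implicit Defensive.

Record hs_instance := HSInstance {
  universe_size : nat;
  hs_family : {set {set 'I_universe_size}};
  budget : nat }.

Definition yes_instance (I : hs_instance) : Prop :=
  exists H : {set 'I_(universe_size I)},
    #|H| <= budget I /\ (forall A, A \in hs_family I -> A :&: H != set0).

Definition equivalent (I J : hs_instance) : Prop :=
  yes_instance I <-> yes_instance J.

Definition linear_family (n : nat) (F : {set {set 'I_n}}) : Prop :=
  forall A B, A \in F -> B \in F -> A != B -> #|A :&: B| <= 1.

(* [No] is never part of an encoded instance: it is the answer "NO instance". *)
Inductive symbol := Bit of bool | Sep | No.

(* Most significant bit first, without leading zeros; zero is the empty word. *)
Definition binary_numeral (k : nat) (b : seq bool) : Prop :=
  foldl (fun v (d : bool) => v.*2 + d) 0 b = k /\ head true b.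

Definition incidence_row (n : nat) (A : {set 'I_n}) : seq bool :=
  [seq i \in A | i <- enum 'I_n].

(* A word encodes I when it is
     <universe size> Sep <number m of sets> Sep <m x n incidence matrix> Sep
     <budget>,
   the three numbers in binary and the rows of the matrix in any order. The
   budget, which is not bounded in terms of the universe size, comes last so
   that its length does not affect the addresses of the rest of the input. *)
Definition encodes (I : hs_instance) (w : seq symbol) : Prop :=
  exists (bn bm bk : seq bool) (s : seq {set 'I_(universe_size I)}),
    [/\ binary_numeral (universe_size I) bn,
        binary_numeral (size s) bm,
        binary_numeral (budget I) bk,
        uniq s /\ s =i hs_family I
      & w = map Bit bn ++ Sep :: map Bit bm ++ Sep ::
            map Bit (flatten (map (@incidence_row _) s)) ++ Sep :: map Bit bk].

(* A random-access machine over natural numbers, with a read-only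
   random-access input, a write-only output stream and a read-write memory.
   The parameters d, a, b below are addresses of memory cells. *)
Inductive binop := OpAdd | OpSub | OpMul | OpDiv | OpMod.

Inductive program :=
  | Const (d c : nat)                (* M[d] := c *)
  | Op (o : binop) (d a b : nat)     (* M[d] := M[a] o M[b] *)
  | LoadInd (d a : nat)              (* M[d] := M[M[a]] *)
  | StoreInd (a b : nat)             (* M[M[a]] := M[b] *)
  | Read (d a : nat)                 (* M[d] := code of input symbol M[a] *)
  | Write (x : symbol)               (* append x to the output *)
  | Seq (p q : program)
  | If (a : nat) (p q : program)     (* p if M[a] is nonzero, q otherwise *)
  | While (a : nat) (p : program).   (* repeat p as long as M[a] is nonzero *)

Definition eval_binop (o : binop) : nat -> nat -> nat :=
  match o with
  | OpAdd => addn | OpSub => subn | OpMul => muln | OpDiv => divn | OpMod => modn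
  end.

Definition symbol_code (x : option symbol) : nat :=
  match x with
  | Some (Bit b) => b
  | Some Sep => 2
  | Some No => 3
  | None => 4 (* past the end of the input *)
  end.

(* Cells 0, 1, ... up to the highest one written so far; the others hold 0. *)
Definition memory := seq nat.

Definition read (M : memory) (a : nat) : nat := nth 0 M a.
Definition write (M : memory) (a v : nat) : memory := set_nth 0 M a v.

Definition bit_length (v : nat) : nat := (trunc_log 2 v).+1.

(* Every cell up to the highest one written is charged, cells holding 0 too. *)
Definition space (M : memory) : nat := \sum_(v <- M) bit_length v.

(* [exec w B p M M' out]: on input w, program p started with memory M
   terminates with memory M', writes out, and the memory occupies at most B
   bits after each instruction. *)
Inductive exec (w : seq symbol) (B : nat) :
    program -> memory -> memory -> seq symbol -> Prop :=
  | ExecConst d c M :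
      space (write M d c) <= B ->
      exec w B (Const d c) M (write M d c) [::]
  | ExecOp o d a b M :
      space (write M d (eval_binop o (read M a) (read M b))) <= B ->
      exec w B (Op o d a b) M
        (write M d (eval_binop o (read M a) (read M b))) [::]
  | ExecLoadInd d a M :
      space (write M d (read M (read M a))) <= B ->
      exec w B (LoadInd d a) M (write M d (read M (read M a))) [::]
  | ExecStoreInd a b M :
      space (write M (read M a) (read M b)) <= B ->
      exec w B (StoreInd a b) M (write M (read M a) (read M b)) [::]
  | ExecRead d a M :
      space (write M d (symbol_code (onth w (read M a)))) <= B ->
      exec w B (Read d a) M (write M d (symbol_code (onth w (read M a)))) [::]
  | ExecWrite x M :
      exec w B (Write x) M M [:: x]
  | ExecSeq p q M M' M'' u v :
      exec w B p M M' u -> exec w B q M' M'' v ->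
      exec w B (Seq p q) M M'' (u ++ v)
  | ExecIfTrue a p q M M' u :
      read M a != 0 -> exec w B p M M' u -> exec w B (If a p q) M M' u
  | ExecIfFalse a p q M M' u :
      read M a = 0 -> exec w B q M M' u -> exec w B (If a p q) M M' u
  | ExecWhileTrue a p M M' M'' u v :
      read M a != 0 -> exec w B p M M' u -> exec w B (While a p) M' M'' v ->
      exec w B (While a p) M M'' (u ++ v)
  | ExecWhileFalse a p M :
      read M a = 0 -> exec w B (While a p) M M [::].

Definition computes_in_space (p : program) (B : nat) (w out : seq symbol) :=
  exists M, exec w B p [::] M out.

(* Main.v *)
Require Import Defs.
From HB Require Import structures.
From mathcomp Require Import all_boot zify.

Set Implicit Arguments.
Unset Strict Implicit.
Unset Printing Implicit Defensive.

(* Replace k by min(k, n). An element of degree greater than k lies in every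
   hitting set of size at most k, because the sets containing it are otherwise
   disjoint. Let S be the set of these elements: the instance is a NO instance
   if |S| > k, and also if more than k^2 sets avoid S, since each of the
   remaining elements hits at most k of them. Otherwise the sets avoiding S
   form the kernel, with budget k - |S|. In each of them only the elements
   shared with another such set and the first private element are kept; by
   linearity at most k^2 elements survive, and no two sets become equal.

   All of this is expressible by bounded sums of input bits, which a RAM
   evaluates with a fixed number of cells holding values polynomial in n. A
   linear family has at most n^2 + 1 sets, so the addresses of the incidence
   matrix are polynomial in n as well. *)

(** * The kernel *)

Section Kernel.
Variable n : nat.
Implicit Types (F G : {set {set 'I_n}}) (A B H : {set 'I_n}).

Definition hits H F := [forall A in F, A :&: H != set0].

Definition degree F (i : 'I_n) := #|[set A in F | i \in A]|.

Definition heavy F k : {set 'I_n} := [set i | k < degree F i].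

Definition unhit F H : {set {set 'I_n}} := [set A in F | A :&: H == set0].

Definition no_private_before G A (i : 'I_n) :=
  [forall (j | j \in A), (j < i) ==> (1 < degree G j)].

Definition trim G A : {set 'I_n} :=
  [set i in A | (1 < degree G i) || no_private_before G A i].

(** * Linear families *)

Lemma linear_family_sub F G :
  G \subset F -> linear_family F -> linear_family G.
Proof. by move=> /subsetP sGF lin A B /sGF FA /sGF FB; apply: lin. Qed.

Lemma linear_family_eq F A B x y : linear_family F -> A \in F -> B \in F ->
  x != y -> x \in A -> x \in B -> y \in A -> y \in B -> A = B.
Proof.
move=> lin FA FB neq xA xB yA yB; apply/eqP/negPn/negP => /(lin _ _ FA FB).
have : [set x; y] \subset A :&: B.
  by apply/subsetP => z; rewrite !inE => /orP[] /eqP->; rewrite ?xA ?xB ?yA ?yB.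
by move/subset_leq_card; rewrite cards2 neq => h1 h2; have := leq_trans h1 h2.
Qed.

(** In a linear family two distinct elements determine the set containing them. So coding a set by a
    pair of its elements, a singleton by a diagonal pair and the empty set by [None] is
    injective. *)
Lemma card_linear_family F : linear_family F -> #|F| <= n ^ 2 + 1.
Proof.
move=> lin.
pose f A : option ('I_n * 'I_n) :=
  if [pick x in A] is Some x then
    if [pick y in A :\ x] is Some y then Some (x, y) else Some (x, x)
  else None.
have -> : n ^ 2 + 1 = #|{: option ('I_n * 'I_n)}|.
  by rewrite card_option card_prod card_ord -mulnn addn1.
have f_inj : {in F &, injective f}.
  move=> A B FA FB; rewrite /f.
  case: (pickP (fun x => x \in A)) => [x xA|A0];
    case: (pickP (fun x => x \in B)) => [x' xB|B0].
  - case: (pickP (fun y => y \in A :\ x)) => [y|A1];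
      case: (pickP (fun y => y \in B :\ x')) => [y'|B1].
    + rewrite !inE => /andP[ny' yB'] /andP[ny yA] [ex ey]; subst x' y'.
      by apply: (linear_family_eq lin FA FB ny).
    + by rewrite !inE => /andP[ny yA] [ex e]; rewrite ex e eqxx in ny.
    + by rewrite !inE => /andP[ny yA] [e e']; rewrite -e -e' eqxx in ny.
    + move=> [ex _]; subst x'; apply/setP => z.
      have := A1 z; have := B1 z; rewrite !inE.
      by case: eqP => [->|_] /= => [_ _|-> ->] //; rewrite xA xB.
  - by case: pickP.
  - by case: pickP.
  - by move=> _; apply/setP => z; rewrite A0 B0.
by rewrite -(card_in_imset f_inj) max_card.
Qed.

(** * Elements of large degree *)

Lemma hitsP H F :
  reflect (forall A, A \in F -> A :&: H != set0) (hits H F).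
Proof. exact: forall_inP. Qed.

(** Suppose [x] is heavy but outside [H]. Sets through [x] share nothing else, so choosing in each
    an element of [H] is injective, and at most [k] sets contain [x]. *)
Lemma heavy_sub_hitting F k H : linear_family F -> #|H| <= k -> hits H F ->
  heavy F k \subset H.
Proof.
move=> lin Hk /hitsP hit; apply/subsetP => x; rewrite inE => hx.
apply/negPn/negP => xH; move: hx; apply/negP; rewrite -leqNgt.
apply: leq_trans Hk; pose f A := odflt x [pick y in A :&: H].
have fP A : A \in F -> f A \in A :&: H.
  by move=> /hit; rewrite /f; case: pickP => // e /set0Pn[y]; rewrite e.
have f_inj : {in [set A in F | x \in A] &, injective f}.
  move=> A B; rewrite !inE => /andP[FA xA] /andP[FB xB] e.
  have := fP A FA; have := fP B FB; rewrite -e !inE => /andP[fB fH] /andP[fA _].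
  apply: (linear_family_eq lin FA FB _ xA xB fA fB).
  by apply: contraNneq xH => ->.
rewrite /degree -(card_in_imset f_inj); apply: subset_leq_card.
apply/subsetP => _ /imsetP[A + ->]; rewrite inE => /andP[/fP + _].
by rewrite inE => /andP[].
Qed.

(** The sets in question are hit by [H] outside the heavy elements: at most [k] elements, each of
    degree at most [k]. *)
Lemma card_unhit_heavy F k H : linear_family F -> #|H| <= k -> hits H F ->
  #|unhit F (heavy F k)| <= k ^ 2.
Proof.
move=> lin Hk /hitsP hit.
have sub : unhit F (heavy F k) \subset
           \bigcup_(x in H :\: heavy F k) [set A in F | x \in A].
  apply/subsetP => A; rewrite inE => /andP[FA /eqP A0].
  have /set0Pn[x] := hit _ FA; rewrite inE => /andP[xA xH].
  apply/bigcupP; exists x; last by rewrite inE FA.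
  rewrite inE xH andbT; apply/negP => xS.
  by have := in_set0 x; rewrite -A0 inE xA xS.
apply: leq_trans (subset_leq_card sub) _.
apply: leq_trans (_ : \sum_(x in H :\: heavy F k) k <= _).
  elim/big_rec2: _ => [|x m T xH IH]; first by rewrite cards0.
  apply: leq_trans (leq_card_setU _ _) _; apply: leq_add => //.
  by move: xH; rewrite !inE -leqNgt => /andP[].
rewrite sum_nat_const -mulnn leq_mul2r; apply/orP; right.
by apply: leq_trans Hk; apply: subset_leq_card; apply: subsetDl.
Qed.

(** * Trimming the sets *)

Lemma trim_sub G A : trim G A \subset A.
Proof. by apply/subsetP => x; rewrite inE => /andP[]. Qed.

(** The least element of [A] satisfies [no_private_before] vacuously, so it is kept whether it is
    shared or private. *)
Lemma trim_neq0 G A : A != set0 -> trim G A != set0.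
Proof.
case/set0Pn => x0 x0A; apply/set0Pn.
case: (arg_minnP (fun i : 'I_n => i : nat) x0A) => x xA x_min.
exists x; rewrite inE; apply/andP; split=> //; apply/orP; right.
by apply/forall_inP => j /x_min; rewrite leqNgt => /negbTE->.
Qed.

Lemma trim_private G A x : x \in A -> degree G x <= 1 ->
  exists2 y, y \in trim G A & degree G y <= 1.
Proof.
move=> xA x1; have Px : (x \in A) && (degree G x <= 1) by rewrite xA.
case: (@arg_minnP _ x (fun i => (i \in A) && (degree G i <= 1))
         (fun i : 'I_n => i : nat) Px) => y /andP[yA y1] y_min.
exists y => //; rewrite inE yA; apply/orP; right; apply/forall_inP => j jA.
apply/implyP; rewrite ltnNge; apply: contraR; rewrite -leqNgt => j1.
by apply: y_min; rewrite jA.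
Qed.

Lemma degree_gt1 G A B x : A \in G -> B \in G -> A != B ->
  x \in A -> x \in B -> 1 < degree G x.
Proof.
move=> GA GB neq xA xB; rewrite /degree.
have <- : #|[set A; B]| = 2 by rewrite cards2 neq.
apply: subset_leq_card; apply/subsetP => C; rewrite !inE.
by case/orP => /eqP->; apply/andP.
Qed.

(** If distinct [A] and [B] had the same trim, it would lie in their intersection, hence be a single
    shared element [x]. All shared elements survive, and some private one does if any exists, so
    both sets would equal the singleton of [x]. *)
Lemma trim_inj G : linear_family G -> {in G &, injective (trim G)}.
Proof.
move=> lin A B GA GB e; apply/eqP/negPn/negP => neq.
have [A0|An0] := eqVneq A set0.
  move: neq; rewrite A0 eq_sym => /(trim_neq0 G); rewrite -e A0.
  by rewrite -subset0 trim_sub.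
have /set0Pn[x xt] := trim_neq0 G An0.
have xA := subsetP (trim_sub G A) _ xt.
have xB : x \in B by apply: (subsetP (trim_sub G B)); rewrite -e.
have x2 := degree_gt1 GA GB neq xA xB.
have trim1 C y : C \in [set A; B] -> y \in trim G C -> y = x.
  rewrite in_set2 => eC yt; apply/eqP/negPn/negP => yx.
  have ytA : y \in trim G A by case/orP: eC yt => /eqP->; rewrite ?e.
  have ytB : y \in trim G B by rewrite -e.
  move/eqP: neq; apply.
  apply: (linear_family_eq lin GA GB yx _ _ xA xB).
    exact: (subsetP (trim_sub G A)).
  exact: (subsetP (trim_sub G B)).
(* A shared [y] survives and so equals [x]; a private [y] would leave a private survivor, which
   cannot be [x]. *)
have single C : C \in [set A; B] -> x \in C -> C = [set x].
  move=> CAB xC; apply/setP => y; rewrite inE; apply/idP/eqP => [yC|-> //].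
  have [y2|y1] := ltnP 1 (degree G y).
    by apply: (trim1 C) => //; rewrite inE yC y2.
  have [z zt z1] := trim_private yC y1.
  by move: z1; rewrite (trim1 C z) // leqNgt x2.
move/eqP: neq; apply; transitivity [set x].
  by apply: single; rewrite ?in_set2 ?eqxx.
by apply/esym/single; rewrite ?in_set2 ?eqxx ?orbT.
Qed.

(** Map each shared element of [A] to another set of [G] containing it, and the one retained private
    element to [A] itself. By linearity two shared elements cannot go to the same set. *)
Lemma card_trim G A : linear_family G -> A \in G -> #|trim G A| <= #|G|.
Proof.
move=> lin GA.
pose f i := if 1 < degree G i then odflt A [pick B in G :\ A | i \in B] else A.
have fP i : i \in A -> 1 < degree G i -> f i \in G :\ A /\ i \in f i.
  move=> iA i2; rewrite /f i2; case: pickP => [B /andP[]|noB] //=.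
  suff : degree G i <= 1 by rewrite leqNgt i2.
  rewrite /degree -(cards1 A); apply: subset_leq_card; apply/subsetP => B.
  rewrite !inE => /andP[GB iB]; apply/negPn/negP => BA.
  by have := noB B; rewrite !inE BA GB iB.
have f_inj : {in trim G A &, injective f}.
  move=> i j; rewrite !inE => /andP[iA ti] /andP[jA tj] e.
  apply/eqP/negPn/negP => neq.
  have [i2|i1] := ltnP 1 (degree G i); have [j2|j1] := ltnP 1 (degree G j).
  - have [] := fP i iA i2; rewrite !inE => /andP[+ Gf] i_f.
    have [_] := fP j jA j2; rewrite -e => j_f /eqP; apply.
    exact: (linear_family_eq lin Gf GA neq).
  - have [] := fP i iA i2; rewrite e {1}/f ltnNge j1 /=.
    by rewrite !inE eqxx.
  - have [] := fP j jA j2; rewrite -e {1}/f ltnNge i1 /=.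
    by rewrite !inE eqxx.
  (* Both elements are private and retained, so neither precedes the other. *)
  - move: ti tj; rewrite !ltnNge i1 j1 /= => /forall_inP fi /forall_inP fj.
    have := fi j jA; have := fj i iA; rewrite !ltnNge i1 j1 /= !implybF.
    rewrite !negbK => ji ij; move/eqP: neq; apply; apply/val_inj.
    by apply/eqP; rewrite eqn_leq ji ij.
rewrite -(card_in_imset f_inj); apply: subset_leq_card.
apply/subsetP => _ /imsetP[i + ->]; rewrite inE => /andP[iA _].
have [i2|i1] := ltnP 1 (degree G i).
  by have [] := fP i iA i2; rewrite inE => /andP[].
by rewrite /f ltnNge i1.
Qed.

Lemma linear_family_trim G : linear_family G ->
  linear_family [set trim G A | A in G].
Proof.
move=> lin _ _ /imsetP[A GA ->] /imsetP[B GB ->] neq.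
have /(lin A B GA GB) : A != B by apply: contraNneq neq => ->.
by apply: leq_trans; apply: subset_leq_card; apply: setISS; apply: trim_sub.
Qed.

(* An element dropped from a set lies in no other set, so a hitting set may
   exchange it for any element that the set retains. *)
Lemma hits_trim G H : hits H G ->
  exists2 H' : {set 'I_n}, #|H'| <= #|H| & hits H' [set trim G A | A in G].
Proof.
move=> /hitsP hit.
(* [ok h j] says that [j] can replace [h] in a hitting set after trimming. *)
pose ok h j := [forall (B | B \in G), (h \in B) ==> (j \in trim G B)].
have okE h : exists j, ok h j.
  (* If [h] cannot stand for itself, it was dropped from some [B], so no other set contains it, and
     any element that [B] retains will do. *)
  have [|] := boolP (ok h h); first by exists h.
  rewrite negb_forall_in => /existsP[B /andP[GB]].
  rewrite negb_imply => /andP[hB]; rewrite !inE hB negb_or /= -leqNgt => /andP[h1 _].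
  have /set0Pn[j jt] : trim G B != set0.
    by apply: trim_neq0; apply/set0Pn; exists h.
  exists j; apply/forall_inP => C GC; apply/implyP => hC.
  have [<- //|neq] := eqVneq B C.
  by have := degree_gt1 GB GC neq hB hC; rewrite ltnNge h1.
pose f h := odflt h [pick j | ok h j].
have fP h : ok h (f h).
  by rewrite /f; case: pickP => [//|no]; have [j] := okE h; rewrite no.
exists [set f h | h in H]; first exact: leq_imset_card.
apply/hitsP => _ /imsetP[A GA ->].
have /set0Pn[h] := hit _ GA; rewrite inE => /andP[hA hH].
apply/set0Pn; exists (f h); rewrite inE imset_f // andbT.
by have /forall_inP/(_ _ GA)/implyP := fP h; apply.
Qed.

(** * Equivalence of the kernel *)

Definition kernel_family F k :=
  let G := unhit F (heavy F k) in [set trim G A | A in G].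

Lemma unhit_sub F H : unhit F H \subset F.
Proof. by apply/subsetP => A; rewrite inE => /andP[]. Qed.

(** Forwards, remove the heavy elements from [H], which contains them all, and adapt the rest to the
    trimmed sets. Backwards, add them again: they hit every discarded set, and the other sets
    contain their trims. The bound on their number makes the truncated subtraction exact. *)
Lemma kernel_equiv F k : linear_family F -> #|heavy F k| <= k ->
  (exists2 H : {set 'I_n}, #|H| <= k & hits H F) <->
  (exists2 H : {set 'I_n},
     #|H| <= k - #|heavy F k| & hits H (kernel_family F k)).
Proof.
set S := heavy F k => lin Sk; split=> -[H Hk hit].
  have SH : S \subset H by apply: heavy_sub_hitting.
  have hit' : hits (H :\: S) (unhit F S).
    apply/hitsP => A; rewrite inE => /andP[FA /eqP A0].
    have /set0Pn[h] := hitsP _ _ hit _ FA; rewrite inE => /andP[hA hH].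
    apply/set0Pn; exists h; rewrite in_setI in_setD hA hH andbT /=.
    by apply/negP => hS; have := in_set0 h; rewrite -A0 inE hA hS.
  have [H' H'c H'h] := hits_trim hit'; exists H' => //.
  apply: leq_trans H'c _; rewrite cardsD (setIidPr SH).
  exact: leq_sub2r.
exists (S :|: H).
  by apply: leq_trans (leq_card_setU _ _) _; rewrite -leq_subRL.
apply/hitsP => A FA.
have [A0|/set0Pn[x]] := eqVneq (A :&: S) set0; last first.
  by rewrite inE => /andP[xA xS]; apply/set0Pn; exists x; rewrite in_setI in_setU xA xS.
have GA : A \in unhit F S by rewrite inE FA A0 eqxx.
have /set0Pn[h] := hitsP _ _ hit _ (imset_f (trim (unhit F S)) GA).
rewrite inE => /andP[/(subsetP (trim_sub _ _)) hA hH].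
by apply/set0Pn; exists h; rewrite !inE hA hH orbT.
Qed.

(** A hitting set never has more than [n] elements, so the budget can be capped at [n] and stored in
    logarithmic space. *)
Lemma yes_instanceP F k :
  yes_instance (HSInstance F k) <->
  exists2 H : {set 'I_n}, #|H| <= minn k n & hits H F.
Proof.
split=> [[H /= [Hk hit]]|[H Hk /hitsP hit]]; exists H.
- by rewrite leq_min Hk (leq_trans (max_card _)) ?card_ord.
- exact/hitsP.
- by split=> //=; apply: leq_trans Hk (geq_minl _ _).
Qed.

End Kernel.

(** * Expressions with bounded sums *)

Arguments read : simpl never.

(* [Sum x y e] is the sum of [e] over all values of variable [x] below the
   value of variable [y]. *)
Inductive expr :=
  | Var (x : nat)
  | Cst (c : nat)
  | Bin (o : binop) (a b : expr)
  | Inp (a : expr)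
  | Sum (x y : nat) (e : expr).

Definition env := nat -> nat.

Definition upd (E : env) x v : env := fun y => if y == x then v else E y.

(** The machine has no move instruction: the target is cleared and the source added, so the two
    cells must differ. *)
Definition copy d s := Seq (Const d 0) (Op OpAdd d s d).

(* The value goes to cell [d]; cells above [d] are overwritten, and the bound
   variable of a sum is saved in cell [d + 1] and restored afterwards. *)
Fixpoint comp (e : expr) (d : nat) : program :=
  match e with
  | Var x => copy d x
  | Cst c => Const d c
  | Bin o a b => Seq (comp a d) (Seq (comp b d.+1) (Op o d d d.+1))
  | Inp a => Seq (comp a d) (Read d d)
  | Sum x y e =>
      Seq (copy d.+1 x) (Seq (copy d.+2 y) (Seq (Const d 0)
        (Seq (While d.+2
                (Seq (Const d.+3 1) (Seq (Op OpSub d.+2 d.+2 d.+3)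
                  (Seq (copy x d.+2) (Seq (comp e d.+3)
                    (Op OpAdd d d d.+3))))))
             (copy x d.+1))))
  end.

(** The number of cells from [d] upwards that [comp e d] may overwrite. A sum takes three before its
    body: accumulator, saved variable and counter. *)
Fixpoint scratch (e : expr) : nat :=
  match e with
  | Var _ | Cst _ => 1
  | Bin _ a b => maxn (scratch a) (scratch b).+1
  | Inp a => scratch a
  | Sum _ _ e => (scratch e).+3
  end.

(* A bound on the degree of the value as a polynomial in the variables. *)
Fixpoint growth (e : expr) : nat :=
  match e with
  | Var _ | Cst _ => 1
  | Bin OpAdd a b => (maxn (growth a) (growth b)).+1
  | Bin OpMul a b => growth a + growth b
  | Bin _ a b => maxn (growth a) (growth b)
  | Inp a => growth a
  | Sum _ _ e => (growth e).+1
  end.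

(** Constants are kept below 5, like the symbol codes, so that any bound of at least 5 covers
    both. *)
Fixpoint closed_below (V : nat) (e : expr) : bool :=
  match e with
  | Var x => x < V
  | Cst c => c < 5
  | Bin _ a b => closed_below V a && closed_below V b
  | Inp a => closed_below V a
  | Sum x y e => [&& x < V, y < V & closed_below V e]
  end.

(** * Correctness and space of compiled expressions *)

Section Machine.
Variable w : seq symbol.

Fixpoint eval (E : env) (e : expr) : nat :=
  match e with
  | Var x => E x
  | Cst c => c
  | Bin o a b => eval_binop o (eval E a) (eval E b)
  | Inp a => symbol_code (onth w (eval E a))
  | Sum x y e => \sum_(i < E y) eval (upd E x i) e
  end.

(* [V] cells hold the variables, cells [V] to [N - 1] are scratch space;
   variables stay below [X] and scratch cells below [X ^ D]. *)
Variables V N X D : nat.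
Hypothesis X_ge5 : 5 <= X.
Hypothesis D_gt0 : 0 < D.

Definition space_bound := N * bit_length (X ^ D).
Local Notation B := space_bound.

(** Fixing the size to [N] means that no write extends the memory, so the space bound reduces to a
    bound on each cell. *)
Definition ok (M : memory) := size M = N /\ (forall c, read M c <= X ^ D).

Definition agree (E : env) (M : memory) :=
  forall x, x < V -> read M x = E x /\ E x <= X.

Lemma ok_space M : ok M -> space M <= B.
Proof.
move=> [sM leM]; rewrite /space /B -sM.
rewrite big_tnth; apply: leq_trans (_ : \sum_(i < size M) bit_length (X ^ D) <= _).
  apply: leq_sum => i _; rewrite /bit_length ltnS; apply: leq_trunc_log.
  by rewrite (tnth_nth 0) /=; apply: leM.
by rewrite sum_nat_const card_ord.
Qed.

Lemma read_write M a v c : read (write M a v) c = if c == a then v else read M c.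
Proof. by rewrite /read /write nth_set_nth /=. Qed.

Lemma ok_write M a v : ok M -> a < N -> v <= X ^ D -> ok (write M a v).
Proof.
move=> [sM leM] aN vK; split.
  by rewrite /write size_set_nth sM; apply/maxn_idPr.
by move=> c; rewrite read_write; case: eqP.
Qed.

Lemma X_le_pow : X <= X ^ D.
Proof. by rewrite -{1}(expn1 X) leq_pexp2l //; lia. Qed.

Lemma small_le_pow c : c <= 5 -> c <= X ^ D.
Proof. by move=> h; apply: leq_trans X_le_pow; lia. Qed.

Lemma growth_gt0 e : 0 < growth e.
Proof. by elim: e => //= [[]] a IHa b IHb; lia. Qed.

(** An addition costs one more factor [X], which absorbs 2; a sum costs one too, having at most [X]
    terms. The remaining operations do not exceed their first operand, apart from products, where
    degrees add up. *)
Lemma eval_le_growth E e : closed_below V e -> (forall x, x < V -> E x <= X) ->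
  eval E e <= X ^ growth e.
Proof.
have X0 : 0 < X by lia.
have up a p q : p <= q -> a <= X ^ p -> a <= X ^ q.
  by move=> pq ap; apply: leq_trans ap _; apply: leq_pexp2l.
elim: e E => [x|c|o a IHa b IHb|a IHa|x y e IHe] E /=.
- by rewrite expn1 => h /(_ _ h).
- by rewrite expn1 => *; lia.
- move=> /andP[ca cb] HE; have {IHa}ha := IHa E ca HE.
  have {IHb}hb := IHb E cb HE; case: o => /=.
  + rewrite expnS; apply: (leq_trans (n := 2 * X ^ maxn (growth a) (growth b))).
      rewrite mul2n -addnn; apply: leq_add; apply: up; first exact: leq_maxl.
      * exact: ha.
      * exact: leq_maxr.
      * exact: hb.
    by rewrite leq_mul2r; apply/orP; right; lia.
  + apply: leq_trans (leq_subr _ _) _; apply: up ha; exact: leq_maxl.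
  + by rewrite expnD; apply: leq_mul.
  + apply: leq_trans (leq_div _ _) _; apply: up ha; exact: leq_maxl.
  + apply: leq_trans (leq_mod _ _) _; apply: up ha; exact: leq_maxl.
- move=> ca HE; apply: (@leq_trans 5); first by case: onth => [[[]||]|].
  by apply: leq_trans X_ge5 _; rewrite -{1}(expn1 X); apply: leq_pexp2l => //;
     apply: growth_gt0.
- move=> /and3P[xV yV ce] HE; rewrite expnS.
  apply: (@leq_trans (\sum_(i < E y) X ^ growth e)).
    apply: leq_sum => i _; apply: IHe => // z zV; rewrite /upd.
    case: eqP => _; last exact: HE.
    by apply: leq_trans (HE y yV); apply: ltnW.
  by rewrite sum_nat_const card_ord leq_mul2r HE ?orbT.
Qed.

Lemma eval_le_pow E e : closed_below V e -> (forall x, x < V -> E x <= X) ->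
  growth e <= D -> eval E e <= X ^ D.
Proof.
move=> ce HE gD; apply: leq_trans (eval_le_growth ce HE) _.
by apply: leq_pexp2l => //; lia.
Qed.

Lemma exec_const d c M : ok M -> d < N -> c <= X ^ D ->
  exec w B (Const d c) M (write M d c) [::].
Proof. by move=> okM dN cK; apply/ExecConst/ok_space/ok_write. Qed.

Lemma exec_op o d a b M : ok M -> d < N ->
  eval_binop o (read M a) (read M b) <= X ^ D ->
  exec w B (Op o d a b) M
    (write M d (eval_binop o (read M a) (read M b))) [::].
Proof. by move=> okM dN cK; apply/ExecOp/ok_space/ok_write. Qed.

Lemma exec_seq p q M M1 M2 :
  exec w B p M M1 [::] -> exec w B q M1 M2 [::] ->
  exec w B (Seq p q) M M2 [::].
Proof. by move=> h1 h2; rewrite -(cats0 [::]); apply: ExecSeq h1 h2. Qed.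

Lemma exec_copy d s M : ok M -> d < N -> d != s ->
  exists M', [/\ exec w B (copy d s) M M' [::], ok M'
    & forall c, read M' c = if c == d then read M s else read M c].
Proof.
move=> okM dN ds; have ok1 : ok (write M d 0) by apply: ok_write.
have e : eval_binop OpAdd (read (write M d 0) s) (read (write M d 0) d) = read M s.
  by rewrite /= !read_write eqxx addn0 eq_sym (negbTE ds).
exists (write (write M d 0) d (read M s)); split.
- apply: exec_seq; first exact: exec_const.
  by rewrite -e; apply: exec_op => //; rewrite e; apply okM.2.
- by apply: ok_write => //; apply okM.2.
- by move=> c; rewrite !read_write; case: (c == d).
Qed.

Lemma agree_le E M : agree E M -> forall x, x < V -> E x <= X.
Proof. by move=> h x /h[]. Qed.

Lemma agree_same E M M' : agree E M ->
  (forall c, c < V -> read M' c = read M c) -> agree E M'.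
Proof. by move=> h e x xV; rewrite e //; apply: h. Qed.

Lemma exec_comp e d E M : closed_below V e -> growth e <= D ->
  V <= d -> d + scratch e <= N -> ok M -> agree E M ->
  exists M', [/\ exec w B (comp e d) M M' [::], ok M',
    forall c, c < d -> read M' c = read M c & read M' d = eval E e].
Proof.
elim: e d E M => [x|c|o a IHa b IHb|a IHa|x y e IHe] d E M ce gD Vd dN okM agM.
- have [||M' [ex ok' rd]] := @exec_copy d x M okM.
  + by move: dN => /=; lia.
  + by move: ce => /=; lia.
  exists M'; split=> //=.
    by move=> c cd; rewrite rd; case: eqP => [h|//]; move: cd; rewrite h ltnn.
  by rewrite rd eqxx; case: (agM x ce).
- have cK : c <= X ^ D by apply: small_le_pow; move: ce => /=; lia.
  exists (write M d c); split=> /=.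
  + by apply: exec_const => //; move: dN => /=; lia.
  + by apply: ok_write => //; move: dN => /=; lia.
  + by move=> i id; rewrite read_write; case: eqP => [h|//]; lia.
  + by rewrite read_write eqxx.
- move: (ce) => /= /andP[ca cb].
  have [||M1 [ex1 ok1 fr1 v1]] := IHa d E M ca _ Vd _ okM agM.
  + by move: gD; case: (o) => /=; lia.
  + by move: dN => /=; lia.
  have ag1 : agree E M1 by apply: agree_same agM _ => c cV; apply: fr1; lia.
  have [|||M2 [ex2 ok2 fr2 v2]] := IHb d.+1 E M1 cb _ _ _ ok1 ag1.
  + by move: gD; case: (o) => /=; lia.
  + lia.
  + by move: dN => /=; lia.
  have e2 : eval_binop o (read M2 d) (read M2 d.+1) = eval E (Bin o a b).
    by rewrite v2 fr2 ?v1.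
  have le2 : eval E (Bin o a b) <= X ^ D.
    by apply: eval_le_pow => //; apply: agree_le agM.
  have dN' : d < N by move: dN => /=; lia.
  exists (write M2 d (eval E (Bin o a b))); split.
  + apply: exec_seq ex1 _; apply: exec_seq ex2 _.
    by rewrite -e2; apply: exec_op => //; rewrite e2.
  + exact: ok_write.
  + move=> c cd; rewrite read_write; case: eqP => [h|_]; first by lia.
    by rewrite fr2 ?fr1 //; lia.
  + by rewrite read_write eqxx.
- have [M1 [ex1 ok1 fr1 v1]] := IHa d E M ce gD Vd dN okM agM.
  have sc : 0 < scratch a by elim: (a) => //= *; lia.
  have dN' : d < N by move: dN => /=; lia.
  have le : eval E (Inp a) <= X ^ D.
    by apply: eval_le_pow => //; apply: agree_le agM.
  exists (write M1 d (eval E (Inp a))); split.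
  + apply: exec_seq ex1 _; rewrite /= -v1; apply: ExecRead.
    by rewrite v1; apply: ok_space; apply: ok_write.
  + exact: ok_write.
  + by move=> c cd; rewrite read_write; case: eqP => [h|_]; [lia|exact: fr1].
  + by rewrite read_write eqxx.
- move: (ce) => /= /and3P[xV yV ce']; move: (dN) => /= dN'.
  have sc : 0 < scratch e by elim: (e) => //= *; lia.
  have [||M1 [ex1 ok1 r1]] := @exec_copy d.+1 x M okM; [lia|lia|].
  have [||M2 [ex2 ok2 r2]] := @exec_copy d.+2 y M1 ok1; [lia|lia|].
  have ok3 : ok (write M2 d 0) by apply: ok_write => //; lia.
  have ex3 : exec w B (Const d 0) M2 (write M2 d 0) [::].
    by apply: exec_const => //; lia.
  set body := Seq (Const d.+3 1) _.
  have le : eval E (Sum x y e) <= X ^ D.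
    by apply: eval_le_pow => //; apply: agree_le agM.
  pose f i := eval (upd E x i) e.
  have evalE : eval E (Sum x y e) = \sum_(0 <= i < E y) f i by rewrite big_mkord.
  (* The counter in cell [d.+2] runs downwards, so when it holds [t] the accumulator contains the
     terms from [t] on. Cell [x] is exempt from the frame condition because the loop uses it as
     bound variable. *)
  have loop t : forall M0, t <= E y -> ok M0 ->
      read M0 d.+2 = t -> read M0 d.+1 = E x ->
      read M0 d = \sum_(t <= i < E y) f i ->
      (forall c, c < d -> c != x -> read M0 c = read M c) ->
      exists M', [/\ exec w B (While d.+2 body) M0 M' [::], ok M',
        read M' d.+1 = E x, read M' d = eval E (Sum x y e)
        & forall c, c < d -> c != x -> read M' c = read M c].
    elim: t => [|t IHt] M0 tE ok0 c2 c1 cd fr.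
      exists M0; split=> //; first exact: ExecWhileFalse.
      by rewrite cd evalE.
    have okA : ok (write M0 d.+3 1) by apply: ok_write => //; [lia|exact: small_le_pow].
    pose MA := write M0 d.+3 1.
    have rMA c : read MA c = if c == d.+3 then 1 else read M0 c by exact: read_write.
    have vB : eval_binop OpSub (read MA d.+2) (read MA d.+3) = t.
      by rewrite /= !(read_write, rMA) eqxx (_ : d.+2 == d.+3 = false) ?c2 ?subn1 //; lia.
    have tX : t <= X by have [_] := agM y yV; lia.
    have tK : t <= X ^ D by apply: leq_trans tX X_le_pow.
    have okB : ok (write MA d.+2 t) by apply: ok_write => //; lia.
    have exB : exec w B (Op OpSub d.+2 d.+2 d.+3) MA (write MA d.+2 t) [::].
      by rewrite -vB; apply: exec_op => //; [lia|rewrite vB].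
    have [||MC [exC okC rC]] := @exec_copy x d.+2 _ okB; [lia|lia|].
    have agC : agree (upd E x t) MC.
      move=> c cV; rewrite rC !(read_write, rMA) /upd.
      case: (eqVneq c x) => [_|cx]; first by rewrite eqxx.
      by have [e1 e2] := agM c cV; rewrite -e1 ifF ?ifF ?fr //; lia.
    have [|||MD [exD okD frD vD]] := IHe d.+3 _ MC ce' _ _ _ okC agC.
    + by move: gD => /=; lia.
    + lia.
    + lia.
    have rd : read MD d = \sum_(t.+1 <= i < E y) f i.
      rewrite frD; last by lia.
      by rewrite rC !(read_write, rMA) -cd; do 3 (rewrite ifF; last by lia).
    have vE : eval_binop OpAdd (read MD d) (read MD d.+3) = \sum_(t <= i < E y) f i.
      by rewrite /= rd vD [in RHS]big_ltn // addnC.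
    have leE : \sum_(t <= i < E y) f i <= X ^ D.
      apply: leq_trans le; rewrite evalE (@big_cat_nat _ _ _ t 0 (E y)) //=;
        [exact: leq_addl|lia].
    have okE : ok (write MD d (\sum_(t <= i < E y) f i)) by apply: ok_write => //; lia.
    have exE : exec w B (Op OpAdd d d d.+3) MD
        (write MD d (\sum_(t <= i < E y) f i)) [::].
      by rewrite -vE; apply: exec_op => //; [lia|rewrite vE].
    have [|||||M' [exW okW w1 w2 w3]] := IHt (write MD d (\sum_(t <= i < E y) f i)) _ okE.
    + lia.
    + rewrite read_write ifF ?frD ?rC ?read_write ?rMA; try lia.
      by rewrite ifF ?eqxx //; lia.
    + rewrite read_write ifF ?frD ?rC ?read_write ?rMA; try lia.
      by do 3 (rewrite ifF; last by lia).
    + by rewrite read_write eqxx.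
    + move=> c cd' cx; rewrite read_write ifF ?frD ?rC ?read_write ?rMA; try lia.
      by do 3 (rewrite ifF; last by lia); apply: fr.
    exists M'; split=> //; rewrite -(cats0 [::]).
    apply: ExecWhileTrue exW; first by rewrite c2.
    apply: exec_seq (exec_const _ _ _) _ => //; first by lia.
      exact: small_le_pow.
    by apply: exec_seq exB _; apply: exec_seq exC _; apply: exec_seq exD _.
  have [Ex ExX] := agM x xV; have [Ey EyX] := agM y yV.
  have [||||M4 [ex4 ok4 r41 r4 fr4]] := loop (E y) (write M2 d 0) (leqnn _) ok3.
  + rewrite read_write ifF; last by lia.
    by rewrite r2 eqxx r1 -Ey ifF //; lia.
  + rewrite read_write ifF; last by lia.
    by rewrite r2 ifF; [rewrite r1 eqxx|lia].
  + by rewrite read_write eqxx big_geq.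
  + move=> c cd cx; rewrite read_write ifF; last by lia.
    by rewrite r2 ifF; [rewrite r1 ifF //; lia|lia].
  have [||M5 [ex5 ok5 r5]] := @exec_copy x d.+1 M4 ok4; [lia|lia|].
  exists M5; split=> //.
  + by apply: exec_seq ex1 _; apply: exec_seq ex2 _; apply: exec_seq ex3 _;
       apply: exec_seq ex4 ex5.
  (* The final copy has restored [x] from cell [d.+1], which completes the frame condition. *)
  + move=> c cd; rewrite r5; case: eqP => [->|/eqP cx]; first by rewrite r41.
    exact: fr4.
  + by rewrite r5 ifF ?r4 //; lia.
Qed.

(** * Weakest preconditions *)

Definition rep (E : env) (M : memory) := ok M /\ agree E M.

(** This is total correctness within the space bound. Environments describe the variables only; the
    contents of scratch cells stay hidden behind [rep]. *)
Definition wp (p : program) (E : env) (Q : env -> seq symbol -> Prop) :=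
  forall M, rep E M ->
  exists M' E' u, [/\ exec w B p M M' u, rep E' M' & Q E' u].

Definition asg x e := Seq (comp e V) (copy x V).

Definition fits e := [&& closed_below V e, growth e <= D & V + scratch e <= N].

Lemma wp_asg x e E Q : x < V -> fits e -> eval E e <= X ->
  Q (upd E x (eval E e)) [::] -> wp (asg x e) E Q.
Proof.
move=> xV /and3P[ce ge se] eX q M [okM agM].
have [M1 [ex1 ok1 fr1 v1]] := exec_comp ce ge (leqnn _) se okM agM.
have VN : x < N by move: se; case: (e) => /= *; lia.
have [|M2 [ex2 ok2 r2]] := @exec_copy x V M1 ok1 VN; first by lia.
exists M2, (upd E x (eval E e)), [::]; split=> //.
  exact: exec_seq ex1 ex2.
split=> // c cV; rewrite r2 /upd; case: eqP => _; first by rewrite v1.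
by rewrite fr1 //; apply: agM.
Qed.

Lemma wp_seq p q E Q :
  wp p E (fun E' u => wp q E' (fun E'' v => Q E'' (u ++ v))) ->
  wp (Seq p q) E Q.
Proof.
move=> h M /h[M1 [E1 [u [ex1 rep1 /(_ _ rep1)[M2 [E2 [v [ex2 rep2 q2]]]]]]]].
by exists M2, E2, (u ++ v); split=> //; apply: ExecSeq ex1 ex2.
Qed.

Lemma wp_write x E Q : Q E [:: x] -> wp (Write x) E Q.
Proof. by move=> q M rM; exists M, E, [:: x]; split=> //; apply: ExecWrite. Qed.

Variable flag : nat.
Hypothesis flag_V : flag < V.

Definition if_ e p q := Seq (asg flag e) (If flag p q).

(** The machine tests a cell, so the guard is evaluated into [flag] before the loop and again after
    each pass. *)
Definition while_ e p := Seq (asg flag e) (While flag (Seq p (asg flag e))).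

Lemma wp_if e p q E Q : fits e -> eval E e <= X ->
  (eval E e != 0 -> wp p (upd E flag (eval E e)) Q) ->
  (eval E e = 0 -> wp q (upd E flag (eval E e)) Q) -> wp (if_ e p q) E Q.
Proof.
move=> fe eX hp hq; apply: wp_seq; apply: wp_asg => // M rM.
have rf : read M flag = eval E e.
  by have [-> _] := rM.2 flag flag_V; rewrite /upd eqxx.
have [e0|en0] := eqVneq (eval E e) 0.
  have [M1 [E1 [u [h1 h2 h3]]]] := hq e0 _ rM.
  by exists M1, E1, u; split=> //; apply: ExecIfFalse => //; rewrite rf.
have [M1 [E1 [u [h1 h2 h3]]]] := hp en0 _ rM.
by exists M1, E1, u; split=> //; apply: ExecIfTrue => //; rewrite rf.
Qed.

(** [Inv] is required before each evaluation of the guard and speaks of all output since the loop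
    began; [mu] decreases with each pass. The proof is by induction on a bound for [mu]. *)
Lemma wp_while e p (mu : env -> nat) (Inv : env -> seq symbol -> Prop) E Q :
  fits e -> Inv E [::] ->
  (forall E u, Inv E u -> [/\ eval E e <= X,
     eval E e != 0 -> wp p (upd E flag (eval E e))
       (fun E' v => Inv E' (u ++ v) /\ mu E' < mu E) &
     eval E e = 0 -> Q (upd E flag 0) u]) ->
  wp (while_ e p) E Q.
Proof.
move=> fe inv0 step; apply: wp_seq; apply: wp_asg => //.
  by have [] := step _ _ inv0.
rewrite /=; suff loop : forall k E u, mu E <= k -> Inv E u ->
    wp (While flag (Seq p (asg flag e))) (upd E flag (eval E e))
      (fun E' v => Q E' (u ++ v)).
  exact: (loop _ _ [::] (leqnn _) inv0).
elim=> [|k IH] E1 u muk inv1 M rM; have [eX ht hf] := step _ _ inv1;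
  (have rf : read M flag = eval E1 e by
    have [-> _] := rM.2 flag flag_V; rewrite /upd eqxx);
  have [e0|en0] := eqVneq (eval E1 e) 0.
- exists M, (upd E1 flag 0), [::]; split=> //; last by rewrite cats0; apply: hf.
    by apply: ExecWhileFalse; rewrite rf.
  by rewrite -e0.
- by have [M2 [E2 [v [_ _ [_ lt]]]]] := ht en0 _ rM; lia.
- exists M, (upd E1 flag 0), [::]; split=> //; last by rewrite cats0; apply: hf.
    by apply: ExecWhileFalse; rewrite rf.
  by rewrite -e0.
have [M2 [E2 [v [ex2 rep2 [inv2 lt]]]]] := ht en0 _ rM.
have [eX2 _ _] := step _ _ inv2.
have [M3 [E3 [v3 [ex3 rep3 [eE ev]]]]] :=
  @wp_asg flag e E2 (fun E' v => E' = upd E2 flag (eval E2 e) /\ v = [::])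
     flag_V fe eX2 (conj erefl erefl) _ rep2.
subst E3 v3; have [|M4 [E4 [v4 [ex4 rep4 q4]]]] := IH E2 (u ++ v) _ inv2 _ rep3.
  by lia.
exists M4, E4, (v ++ v4); split=> //; last by rewrite catA.
apply: ExecWhileTrue ex4; first by rewrite rf.
by rewrite -(cats0 v); apply: ExecSeq ex2 ex3.
Qed.

End Machine.

Lemma exec_mono w B B' p M M' u :
  B <= B' -> exec w B p M M' u -> exec w B' p M M' u.
Proof.
move=> BB'; elim=> {p M M' u} *;
  first [by constructor; (try apply: leq_trans BB') | econstructor; eassumption].
Qed.

(** * The program *)

Local Notation vn := 0.
Local Notation vm := 1.
Local Notation vbase := 2.
Local Notation vk := 3.
Local Notation vpos := 4.
Local Notation vheavy := 5.
Local Notation vrows := 6.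
Local Notation vflag := 7.
Local Notation vr := 8.
Local Notation vi := 9.
Local Notation vpow := 10.
(* Cells 11 to 14 are the bound variables of sums. *)
Local Notation nvars := 15.
(** This constant and [maxdeg] are chosen so that the conditions [fits] can be checked by
    computation; for the space bound it matters only that they are independent of the input. *)
Local Notation ncells := 60.
Local Notation maxdeg := 40.

Local Notation "a [+] b" := (Bin OpAdd a b) (at level 50, left associativity).
Local Notation "a [-] b" := (Bin OpSub a b) (at level 50, left associativity).
Local Notation "a [*] b" := (Bin OpMul a b) (at level 40, left associativity).
Local Notation "a [/] b" := (Bin OpDiv a b) (at level 40, left associativity).
Local Notation "a [%] b" := (Bin OpMod a b) (at level 40, left associativity).
Local Notation "p ;; q" := (Seq p q) (at level 70, right associativity).
Local Notation "x ::= e" := (asg nvars x e) (at level 65).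
Local Notation IF := (if_ nvars vflag).
Local Notation WHILE := (while_ nvars vflag).

(** Truncated subtraction turns this into the 0/1 indicator of [a < b]. *)
Definition lt_expr a b := Cst 1 [-] (Cst 1 [-] (b [-] a)).

Definition inc_expr x y := Inp ((Var vbase [+] (Var x [*] Var vn)) [+] Var y).

(** Nested sums bind different cells, here and in the expressions below, so that no inner sum
    captures an outer variable. *)
Definition degree_expr y := Sum 11 vm (inc_expr 11 y).

Definition heavy_expr y := lt_expr (Var vk) (degree_expr y).

Definition unhit_expr x :=
  Cst 1 [-] Sum 12 vn (inc_expr x 12 [*] heavy_expr 12).

Definition unhit_degree_expr y := Sum 13 vm (unhit_expr 13 [*] inc_expr 13 y).

(** The factor [2 - degree] is nonzero exactly for private elements, so the inner sum vanishes when
    none precedes [y]. Truth is encoded as any nonzero value. *)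
Definition trim_expr x y :=
  inc_expr x y [*]
    (lt_expr (Cst 1) (unhit_degree_expr y) [+]
     (Cst 1 [-] Sum 14 y (inc_expr x 14 [*] (Cst 2 [-] unhit_degree_expr 14)))).

(** The first loop finds the least power of two above the number; the second halves it and writes
    one digit each time. Hence there are no leading zeros, and zero yields the empty word. *)
Definition write_number x :=
  vpow ::= Cst 1 ;;
  WHILE (Var x [/] Var vpow) (vpow ::= Var vpow [*] Cst 2) ;;
  WHILE (Var vpow [-] Cst 1)
    (vpow ::= Var vpow [/] Cst 2 ;;
     IF ((Var x [/] Var vpow) [%] Cst 2) (Write (Bit true)) (Write (Bit false))).

Definition read_number x c :=
  x ::= Cst 0 ;;
  WHILE c (x ::= (Var x [*] Cst 2) [+] Inp (Var vpos) ;;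
           vpos ::= Var vpos [+] Cst 1).

Definition bit_expr := lt_expr (Inp (Var vpos)) (Cst 2).

Definition write_row :=
  vi ::= Cst 0 ;;
  WHILE (Var vn [-] Var vi)
    (IF (trim_expr vr vi) (Write (Bit true)) (Write (Bit false)) ;;
     vi ::= Var vi [+] Cst 1).

(** The assignment to [vi] in the second branch serves as a skip, since [write_row] resets [vi]
    itself. *)
Definition write_rows :=
  vr ::= Cst 0 ;;
  WHILE (Var vm [-] Var vr)
    (IF (unhit_expr vr) write_row (vi ::= Cst 0) ;;
     vr ::= Var vr [+] Cst 1).

(* The budget has unbounded length: reading it stops at the first prefix with
   a value of at least [n], so that addresses stay polynomial in [n]. *)
Definition parse :=
  vpos ::= Cst 0 ;;
  read_number vn bit_expr ;;
  vpos ::= Var vpos [+] Cst 1 ;;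
  read_number vm bit_expr ;;
  vbase ::= Var vpos [+] Cst 1 ;;
  vpos ::= (Var vbase [+] (Var vm [*] Var vn)) [+] Cst 1 ;;
  read_number vk (bit_expr [*] lt_expr (Var vk) (Var vn)) ;;
  vk ::= Var vk [-] (Var vk [-] Var vn).

(** Only the two counts are stored; sets and degrees are recomputed from the input on demand. Output
    cannot be retracted, so the NO test precedes the first symbol. *)
Definition kernelize :=
  vheavy ::= Sum 12 vn (heavy_expr 12) ;;
  vrows ::= Sum 13 vm (unhit_expr 13) ;;
  IF (lt_expr (Var vk) (Var vheavy) [+]
      lt_expr (Var vk [*] Var vk) (Var vrows))
    (Write No)
    (write_number vn ;; Write Sep ;; write_number vrows ;; Write Sep ;;
     write_rows ;; Write Sep ;;
     vheavy ::= Var vk [-] Var vheavy ;; write_number vheavy).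

(** Writing the last cell first gives the memory the full size that [ok] demands. *)
Definition kernel_program := Const ncells.-1 0 ;; parse ;; kernelize.

(** * Binary numerals *)

Definition bits_value (b : seq bool) : nat :=
  foldl (fun v (d : bool) => v.*2 + d) 0 b.

Lemma bits_value_rcons b d : bits_value (rcons b d) = (bits_value b).*2 + d.
Proof. by rewrite /bits_value foldl_rcons. Qed.

Lemma bits_value_take b t : bits_value (take t b) <= bits_value b.
Proof.
rewrite -{2}(cat_take_drop t b); elim/last_ind: (drop t b) => [|l d IH].
  by rewrite cats0.
by rewrite -rcons_cat bits_value_rcons; lia.
Qed.

(** A crude linear bound on the length is enough to keep input positions below [X]. *)
Lemma size_le_bits_value b : head true b -> size b <= bits_value b.
Proof.
elim/last_ind: b => // b d IH; rewrite bits_value_rcons size_rcons.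
case: b IH => [_|c b IH hb]; first by case: d.
by have := IH hb; rewrite /=; lia.
Qed.

Lemma head_take (b : seq bool) t : head true b -> head true (take t b).
Proof. by case: b t => [|c b] [|t]. Qed.

(** * Reading and writing numbers *)

Section Verification.
Variables (w : seq symbol) (X : nat).
Hypothesis X_ge5 : 5 <= X.

Local Notation wp := (wp w nvars ncells X maxdeg).
Local Notation eval := (eval w).

Lemma asg_rule x e E Q : x < nvars -> fits nvars ncells maxdeg e ->
  eval E e <= X -> Q (upd E x (eval E e)) [::] -> wp (x ::= e) E Q.
Proof. exact: wp_asg. Qed.

Lemma if_rule e p q E Q : fits nvars ncells maxdeg e -> eval E e <= X ->
  (eval E e != 0 -> wp p (upd E vflag (eval E e)) Q) ->
  (eval E e = 0 -> wp q (upd E vflag (eval E e)) Q) -> wp (IF e p q) E Q.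
Proof. exact: wp_if. Qed.

Lemma while_rule e p (mu : env -> nat) (Inv : env -> seq symbol -> Prop) E Q :
  fits nvars ncells maxdeg e -> Inv E [::] ->
  (forall E u, Inv E u -> [/\ eval E e <= X,
     eval E e != 0 -> wp p (upd E vflag (eval E e))
       (fun E' v => Inv E' (u ++ v) /\ mu E' < mu E) &
     eval E e = 0 -> Q (upd E vflag 0) u]) ->
  wp (WHILE e p) E Q.
Proof. exact: wp_while. Qed.

Definition same_but (ys : seq nat) (E E' : env) :=
  forall y, y \notin ys -> E' y = E y.

Lemma same_but_upd ys E E' x v :
  x \in ys -> same_but ys E E' -> same_but ys E (upd E' x v).
Proof.
move=> xys h y yys; rewrite /upd; case: eqP => [e|_]; last exact: h.
by rewrite e xys in yys.
Qed.

Lemma wp_write_number x E Q : x < nvars -> x \notin [:: vpow; vflag] ->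
  (E x).*2 <= X ->
  (forall E' b, binary_numeral (E x) b -> same_but [:: vpow; vflag] E E' ->
     Q E' (map Bit b)) ->
  wp (write_number x) E Q.
Proof.
move=> xV xf xX post; set v := E x.
have fits1 : fits nvars ncells maxdeg (Var x [/] Var vpow).
  by rewrite /fits /= xV.
have fits2 : fits nvars ncells maxdeg ((Var x [/] Var vpow) [%] Cst 2).
  by rewrite /fits /= xV.
apply: wp_seq; apply: asg_rule => //=; first by lia.
apply: wp_seq.
(* The last clause of the invariant makes the power the least one above [v], which bounds it by [X]
   and makes the first digit written a 1. *)
apply: (while_rule (mu := fun E' => v.+1 - E' vpow)
  (Inv := fun E' u => [/\ u = [::], same_but [:: vpow; vflag] E E' &
     exists2 j, E' vpow = 2 ^ j & j = 0 \/ 2 ^ j.-1 <= v])) => //.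
  split=> //; last by exists 0 => //; left.
  exact: same_but_upd.
move=> E1 u [-> same [j pj jv]]; have Ex : E1 x = v by apply: same.
have j_pos : 0 < 2 ^ j by rewrite expn_gt0.
rewrite /= Ex pj; split.
- by have := leq_div v (2 ^ j); lia.
- rewrite -lt0n divn_gt0 // => jle.
  apply: asg_rule => //=; rewrite /upd /= pj; first by lia.
  split; last by lia.
  split=> //.
    by apply: same_but_upd => //; apply: same_but_upd.
  by exists j.+1; [rewrite expnS mulnC|right].
move/eqP; rewrite eqn0Ngt divn_gt0 // -ltnNge => vj.
have jX : 2 ^ j <= X.
  by case: jv => [->|]; [lia|case: (j) => [|i] /=; rewrite ?expnS; lia].
(* The digits written so far are those of [v %/ 2 ^ i]. While there are none, the last clause still
   guarantees that the next digit is not a leading zero. *)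
apply: (while_rule (mu := fun E' => E' vpow)
  (Inv := fun E' u => exists b i, [/\ u = map Bit b /\ 2 ^ i <= X,
     same_but [:: vpow; vflag] E E', E' vpow = 2 ^ i, bits_value b = v %/ 2 ^ i &
     head true b /\ (b = [::] -> i = 0 \/ 2 ^ i.-1 <= v)])) => //.
  exists [::], j; split=> //; first exact: same_but_upd.
  by rewrite divn_small.
move=> E2 {}u [b [i [[-> iX] same2 pi vb [hb b0]]]].
rewrite /= pi; split.
- by apply: leq_trans iX; apply: leq_subr.
- case: i iX pi vb b0 => [|i] iX pi vb b0; first by rewrite expn0.
  move=> _; have i_pos : 0 < 2 ^ i by rewrite expn_gt0.
  have ev c : eval (upd E2 vflag c) (Var vpow [/] Cst 2) = 2 ^ i.
    by rewrite /= /upd /= pi expnS mulKn.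
  apply: wp_seq; apply: asg_rule; rewrite // ev.
    by move: iX; rewrite expnS; lia.
  have vi : (v %/ 2 ^ i) = (v %/ 2 ^ i.+1).*2 + odd (v %/ 2 ^ i).
    by rewrite expnS mulnC divnMA divn2 addnC odd_double_half.
  have bE : bits_value (rcons b (odd (v %/ 2 ^ i))) = v %/ 2 ^ i.
    by rewrite bits_value_rcons vb -vi.
  have hd : head true (rcons b (odd (v %/ 2 ^ i))).
    case: (b) hb vb b0 => //= _ v0 /(_ erefl)[//|iv].
    have : 0 < v %/ 2 ^ i by rewrite divn_gt0.
    by rewrite vi -v0; case: odd.
  have inv E3 : same_but [:: vpow; vflag] E E3 -> E3 vpow = 2 ^ i ->
    (exists b0 i0,
      [/\ map Bit b ++ [:: Bit (odd (v %/ 2 ^ i))] = map Bit b0 /\ 2 ^ i0 <= X,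
          same_but [:: vpow; vflag] E E3, E3 vpow = 2 ^ i0,
          bits_value b0 = v %/ 2 ^ i0
        & head true b0 /\ (b0 = [::] -> i0 = 0 \/ 2 ^ i0.-1 <= v)]) /\
    E3 vpow < 2 ^ i.+1.
    move=> same3 p3; split; last by rewrite p3 expnS; lia.
    exists (rcons b (odd (v %/ 2 ^ i))), i; split=> //.
      rewrite map_rcons cats1; split=> //.
      by move: iX; rewrite expnS; lia.
    by split=> //; case: (b).
  set E3 := upd _ _ _.
  have same3 : same_but [:: vpow; vflag] E E3.
    by apply: same_but_upd => //; apply: same_but_upd.
  have same4 a : same_but [:: vpow; vflag] E (upd E3 vflag a).
    exact: same_but_upd.
  have p3 : E3 vpow = 2 ^ i by rewrite /E3 /upd.
  have bit3 : eval E3 ((Var x [/] Var vpow) [%] Cst 2) = odd (v %/ 2 ^ i).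
    by rewrite /= p3 same3 // modn2.
  apply: if_rule => //; rewrite bit3; first by lia.
    rewrite eqb0 negbK => o1; apply: wp_write.
    by have := inv (upd E3 vflag true) (same4 _) p3; rewrite o1.
  move/eqP; rewrite eqb0 => /negbTE o0; apply: wp_write.
  by have := inv (upd E3 vflag false) (same4 _) p3; rewrite o0.
- move=> i1; apply: post; last exact: same_but_upd.
  split=> //; rewrite -/(bits_value b) vb.
  have -> : i = 0; last by rewrite divn1.
  by case: (i) i1 => // i'; rewrite expnS; have := expn_gt0 2 i'; lia.
Qed.

(* [g] tells whether reading goes on after a prefix with a given value. *)
Lemma wp_read_number x c l (g : pred nat) E Q :
  let pos := E vpos in
  let frame := same_but [:: x; vpos; vflag] E in
  x < nvars -> x != vpos -> x != vflag -> fits nvars ncells maxdeg c ->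
  (forall j, j < size l -> symbol_code (onth w (pos + j)) = nth false l j) ->
  (forall t E', t <= size l -> frame E' ->
     E' x = bits_value (take t l) -> E' vpos = pos + t ->
     eval E' c = (t < size l) && g (bits_value (take t l))) ->
  (forall t, t <= size l -> t = 0 \/ g (bits_value (take t.-1 l)) ->
     bits_value (take t l) <= X /\ pos + t <= X) ->
  (forall t E', t <= size l -> frame E' ->
     E' x = bits_value (take t l) -> E' vpos = pos + t ->
     t = size l \/ ~~ g (bits_value (take t l)) -> Q E' [::]) ->
  wp (read_number x c) E Q.
Proof.
move=> pos frame xV xpos xflag fc bit cond bound post.
have fitx : fits nvars ncells maxdeg ((Var x [*] Cst 2) [+] Inp (Var vpos)).
  by rewrite /fits /= xV.
have upx E' (y : nat) a : y \in [:: vpos; vflag] -> upd E' y a x = E' x.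
  by rewrite /upd; case: eqP => // <-; rewrite !inE (negbTE xpos) (negbTE xflag).
have upv E' a : upd E' x a vpos = E' vpos.
  by rewrite /upd eq_sym (negbTE xpos).
apply: wp_seq; apply: asg_rule => //=.
(* The last clause remembers that the previous prefix passed the test [g]; hypothesis [bound] needs
   this to control the current one. *)
apply: (while_rule (mu := fun E' => pos + size l - E' vpos)
  (Inv := fun E' u => exists t, [/\ u = [::] /\ t <= size l, frame E',
     E' x = bits_value (take t l), E' vpos = pos + t &
     t = 0 \/ g (bits_value (take t.-1 l))])) => //.
  exists 0; split=> //; [ | by rewrite /upd eqxx take0 | by rewrite upv addn0 | by left].
  by apply: same_but_upd => //; rewrite inE eqxx.
move=> E1 u [t [[-> tl] fr xv posv gt]].
rewrite (cond t) //; split; first by case: (_ && _); lia.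
- rewrite eqb0 negbK => /andP[tl' gv].
  have tk : take t.+1 l = rcons (take t l) (nth false l t) by apply: take_nth.
  have [||b1 b2] := bound t.+1; [by []|by right|].
  set E2 := upd _ _ _.
  have fr2 : frame E2 by apply: same_but_upd; rewrite // !inE eqxx !orbT.
  have pos2 : E2 vpos = pos + t by rewrite /E2 /upd /= posv.
  have ev : eval E2 ((Var x [*] Cst 2) [+] Inp (Var vpos)) = bits_value (take t.+1 l).
    rewrite tk bits_value_rcons /= pos2 bit // -muln2 -xv /E2 upx //.
  apply: wp_seq; apply: asg_rule => //; rewrite ev //=.
  apply: asg_rule => //=; rewrite upv pos2; first by rewrite -addnA addn1.
  split; last by rewrite posv /upd /=; lia.
  exists t.+1; split=> //.
  + apply: same_but_upd; first by rewrite !inE eqxx orbT.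
    by apply: same_but_upd; first by rewrite inE eqxx.
  + by rewrite upx // /upd eqxx.
  + by rewrite /upd /=; lia.
  + by right.
- move/eqP; rewrite eqb0 negb_and -leqNgt => h; apply: (post t) => //.
  + by apply: same_but_upd; rewrite // !inE eqxx !orbT.
  + by rewrite upx.
  + by case/orP: h => h; [left; lia|right].
Qed.

End Verification.

(** * Positions in the encoded input *)

Lemma onth_bits u l t j : j < size l ->
  symbol_code (onth (u ++ map Bit l ++ t) (size u + j)) = nth false l j.
Proof.
move=> jl; rewrite !onth_cat ltnNge leq_addr /= addKn size_map jl onth_map.
by rewrite onthE (nth_map false).
Qed.

Lemma nth_flatten_rows (T U : Type) (x : T) (y : U) (f : U -> seq T) n s r i :
  (forall z, size (f z) = n) -> r < size s -> i < n ->
  nth x (flatten (map f s)) (r * n + i) = nth x (f (nth y s r)) i.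
Proof.
move=> sf; elim: s r => // z s IH [|r] /= rs ilt; rewrite nth_cat sf.
  by rewrite mul0n ilt.
by rewrite mulSn -addnA ltnNge leq_addr /= addKn IH.
Qed.

Lemma size_flatten_rows (T U : Type) (f : U -> seq T) n s :
  (forall z, size (f z) = n) -> size (flatten (map f s)) = size s * n.
Proof. by move=> sf; elim: s => //= z s IH; rewrite size_cat sf IH. Qed.

Lemma size_incidence_row n (A : {set 'I_n}) : size (incidence_row A) = n.
Proof. by rewrite size_map size_enum_ord. Qed.

Lemma nth_incidence_row n (A : {set 'I_n}) (i : 'I_n) :
  nth false (incidence_row A) i = (i \in A).
Proof.
by rewrite (nth_map i) ?size_enum_ord // nth_ord_enum.
Qed.

Lemma lt_exprE w E a b : eval w E (lt_expr a b) = (eval w E a < eval w E b).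
Proof. by rewrite /=; case: ltnP => h; lia. Qed.

Lemma eval_bin w E o a b :
  eval w E (Bin o a b) = eval_binop o (eval w E a) (eval w E b).
Proof. by []. Qed.

Lemma eval_sum w E x y e :
  eval w E (Sum x y e) = \sum_(i < E y) eval w (upd E x i) e.
Proof. by []. Qed.

(** * Runs on an encoded instance *)

Section Instance.
Variables (n k : nat) (F : {set {set 'I_n}}) (s : seq {set 'I_n}).
Variables bn bm bk : seq bool.
Hypothesis linF : linear_family F.
Hypothesis bnP : binary_numeral n bn.
Hypothesis bmP : binary_numeral (size s) bm.
Hypothesis bkP : binary_numeral k bk.
Hypothesis s_uniq : uniq s.
Hypothesis sF : s =i F.

Let mat := flatten (map (@incidence_row n) s).
Let w := map Bit bn ++ Sep :: map Bit bm ++ Sep :: map Bit mat ++ Sep :: map Bit bk.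
Let base := size bn + size bm + 2.
Let kk := minn k n.
Let S := heavy F kk.
Let G := unhit F S.
Let row r := nth set0 s r.
Let X := (n + 5) ^ 3.

Local Notation wp := (wp w nvars ncells X maxdeg).
Local Notation eval := (eval w).

Lemma code_inc r (i : 'I_n) : r < size s ->
  symbol_code (onth w (base + r * n + i)) = (i \in row r).
Proof.
move=> rs; have := nth_flatten_rows false set0 (@size_incidence_row n) rs (ltn_ord i).
rewrite nth_incidence_row => <-.
have -> : w = (map Bit bn ++ Sep :: map Bit bm ++ [:: Sep]) ++ map Bit mat ++
              Sep :: map Bit bk by rewrite /w -!catA /= -!catA.
set u := map Bit bn ++ _; have -> : base + r * n + i = size u + (r * n + i).
  by rewrite /u /base !(size_cat, size_map) /= size_cat size_map /=; lia.
rewrite onth_bits // /mat (size_flatten_rows _ (@size_incidence_row n)).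
by have := ltn_ord i; nia.
Qed.

(** The rows come in any order but without repetition, so counting row indices is counting sets. *)
Lemma sum_rows (P : pred {set 'I_n}) :
  \sum_(r < size s) (P (row r) : nat) = #|[set A in F | P A]|.
Proof.
transitivity (\sum_(A <- s) (P A : nat)); first by rewrite (big_nth set0) big_mkord.
transitivity (count P s).
  by rewrite -sum1_count [RHS]big_mkcond; apply: eq_bigr => A _; case: (P A).
rewrite -size_filter -(card_uniqP (filter_uniq P s_uniq)).
by apply: eq_card => A; rewrite inE mem_filter sF andbC.
Qed.

Definition loaded (E : env) :=
  [/\ E vn = n, E vm = size s, E vbase = base & E vk = kk].

Lemma loaded_upd E x v : 3 < x -> loaded E -> loaded (upd E x v).
Proof. by move=> xv [h0 h1 h2 h3]; rewrite /loaded /upd; case: x xv => [|[|[|[|x]]]]. Qed.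

Lemma eval_inc E x y (i : 'I_n) : loaded E -> E x < size s -> E y = i ->
  eval E (inc_expr x y) = (i \in row (E x)).
Proof. by case=> h0 h1 h2 h3 xs yi; rewrite /= h0 h2 yi code_inc. Qed.

Lemma eval_degree E y (i : 'I_n) : loaded E -> y != 11 -> E y = i ->
  eval E (degree_expr y) = degree F i.
Proof.
move=> LE y11 yi; have [_ h1 _ _] := LE; rewrite /degree_expr eval_sum h1.
rewrite /degree -sum_rows; apply: eq_bigr => r _.
rewrite (@eval_inc _ _ _ i) /upd ?eqxx ?(negbTE y11) //.
Qed.

Lemma eval_heavy E y (i : 'I_n) : loaded E -> y != 11 -> E y = i ->
  eval E (heavy_expr y) = (i \in S).
Proof.
move=> LE y11 yi; have [_ _ _ h3] := LE.
by rewrite lt_exprE (eval_degree LE y11 yi) /= h3 inE.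
Qed.

Lemma eval_unhit E x : loaded E -> x != 11 -> x != 12 -> E x < size s ->
  eval E (unhit_expr x) = (row (E x) \in G).
Proof.
move=> LE x11 x12 xs; have [h0 _ _ _] := LE.
have -> : eval E (unhit_expr x) = 1 - \sum_(i < n) ((i \in row (E x)) * (i \in S)).
  rewrite /unhit_expr eval_bin eval_sum h0.
  congr (1 - _); apply: eq_bigr => i _; rewrite eval_bin.
  have LE' := @loaded_upd E 12 i isT LE.
  rewrite (@eval_heavy _ _ i) // (@eval_inc _ _ _ i) //.
    by rewrite /upd (negbTE x12).
  by rewrite /upd (negbTE x12).
have rF : row (E x) \in F by rewrite -sF mem_nth.
rewrite inE rF /=; case: (eqVneq (row (E x) :&: S) set0) => [A0|/set0Pn[j]].
  rewrite big1 // => i _; have := in_set0 i; rewrite -A0 inE.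
  by case: (i \in row _) => //= ->.
rewrite inE => /andP[jA jS]; rewrite (bigD1 j) //= jA jS; lia.
Qed.

Lemma eval_unhit_degree E y (i : 'I_n) : loaded E ->
  y \notin [:: 11; 12; 13] -> E y = i ->
  eval E (unhit_degree_expr y) = degree G i.
Proof.
move=> LE; rewrite !inE !negb_or => /and3P[y11 y12 y13] yi.
have [_ h1 _ _] := LE; rewrite /unhit_degree_expr eval_sum h1.
have -> : degree G i = #|[set A in F | (A \in G) && (i \in A)]|.
  apply: eq_card => A; rewrite !inE.
  by case: (A \in F) => //=; rewrite ?andbF ?andbT.
rewrite -sum_rows; apply: eq_bigr => r _.
rewrite eval_bin.
have LE' := @loaded_upd E 13 r isT LE.
have rs : upd E 13 r 13 < size s by rewrite /upd eqxx.
have yi' : upd E 13 r y = i by rewrite /upd (negbTE y13).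
rewrite (eval_unhit LE' _ _ rs) // (eval_inc LE' rs yi') /upd eqxx /=.
by rewrite mulnb.
Qed.

(** The value may be 2 when the element is shared and also has no private predecessor; the bound
    lets it fit in the flag. *)
Lemma eval_trim E (i : 'I_n) : loaded E -> E vr < size s -> E vi = i ->
  eval E (trim_expr vr vi) <= 2 /\
  (eval E (trim_expr vr vi) != 0) = (i \in trim G (row (E vr))).
Proof.
move=> LE rs vE.
set A := row (E vr).
have -> : eval E (trim_expr vr vi) = (i \in A) *
    ((1 < degree G i) + (1 - \sum_(j < i) eval (upd E 14 j)
       (inc_expr vr 14 [*] (Cst 2 [-] unhit_degree_expr 14)))).
  rewrite /trim_expr eval_bin (eval_inc LE rs vE) eval_bin lt_exprE.
  by rewrite (eval_unhit_degree LE _ vE) // eval_bin eval_sum vE.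
split; first by case: (i \in A); case: ltnP => _ /=; lia.
rewrite inE; case: (i \in A) => //=; rewrite mul1n.
case: ltnP => //= _; rewrite add0n.
(* The index is widened from ['I_i] to ['I_n], so that it denotes an element of the universe. *)
have sumE : \sum_(j < i) eval (upd E 14 j)
      (inc_expr vr 14 [*] (Cst 2 [-] unhit_degree_expr 14)) =
    \sum_(j < n | j < i) (j \in A) * (2 - degree G j).
  rewrite (big_ord_widen n (fun j => eval (upd E 14 j)
    (inc_expr vr 14 [*] (Cst 2 [-] unhit_degree_expr 14)))); last exact: ltnW.
  apply: eq_bigr => j ji.
  have LE' := @loaded_upd E 14 j isT LE.
  rewrite -(@eval_inc (upd E 14 j) vr 14 j) //.
  by rewrite -(@eval_unhit_degree (upd E 14 j) 14 j).
rewrite sumE -lt0n subn_gt0 ltnS leqn0 sum_nat_eq0.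
rewrite /no_private_before; apply/forallP/forall_inP => h j.
  move=> jA; apply/implyP => ji; have := h j; rewrite ji jA /= mul1n.
  by rewrite subn_eq0.
apply/implyP => ji; case: (boolP (j \in A)) => // jA.
by have := h j jA; rewrite ji /= mul1n subn_eq0.
Qed.

Lemma size_rows : size s = #|F|.
Proof. by rewrite -(card_uniqP s_uniq); apply: eq_card. Qed.

(** Linearity enters here: with at most [n ^ 2 + 1] rows, a cubic bound covers the matrix, the
    headers and the part of the budget that is read. *)
Lemma X_large : n * size s + 2 * size s + 4 * n + 20 <= X.
Proof.
have := card_linear_family linF; rewrite -size_rows /X -mulnn => h.
have -> : (n + 5) ^ 3 = n * n * n + 15 * (n * n) + 75 * n + 125.
  by rewrite !expnS expn0; nia.
nia.
Qed.

Lemma X_ge5 : 5 <= X.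
Proof. by have := X_large; lia. Qed.

Lemma loaded_same ys E E' :
  all (leq 4) ys -> same_but ys E E' -> loaded E -> loaded E'.
Proof.
move=> /allP ys4 same [h0 h1 h2 h3].
have same' y : y < 4 -> E' y = E y.
  by move=> y4; apply: same; apply/negP => /ys4; rewrite leqNgt y4.
by split; rewrite same'.
Qed.

(** * Writing the trimmed matrix *)

Lemma wp_write_row E Q : loaded E -> E vr < size s ->
  (forall E', same_but [:: vi; vflag] E E' ->
     Q E' (map Bit (incidence_row (trim G (row (E vr)))))) ->
  wp write_row E Q.
Proof.
move=> LE rs post; pose bits := incidence_row (trim G (row (E vr))).
have Xl := X_large.
apply: wp_seq; apply: (asg_rule X_ge5) => //.
apply: (while_rule X_ge5 (mu := fun E' => n - E' vi)
  (Inv := fun E' u => [/\ same_but [:: vi; vflag] E E', E' vi <= n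
                        & u = map Bit (take (E' vi) bits)])) => //.
  by split; [exact: same_but_upd| |rewrite /upd /= take0].
move=> E1 u [same1 in1 ->].
have LE1 := loaded_same (ys := [:: vi; vflag]) isT same1 LE.
have n1 : E1 vn = n by case: LE1.
have r1 : E1 vr = E vr by apply: same1.
rewrite eval_bin [eval_binop _ _ _]/= n1; split; first by lia.
- rewrite -lt0n subn_gt0 => ilt; pose i := Ordinal ilt.
  set E2 := upd _ _ _.
  have same2 : same_but [:: vi; vflag] E E2 by apply: same_but_upd.
  have LE2 : loaded E2 by apply: loaded_upd.
  have [|le2 tr2] := @eval_trim E2 i LE2 _ (erefl _).
    by rewrite /E2 /upd /= r1.
  (* This restores the invariant for both branches of the conditional at once. *)
  have inv b : b = (i \in trim G (row (E2 vr))) -> forall E3,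
      same_but [:: vflag] E2 E3 ->
      wp (vi ::= Var vi [+] Cst 1) E3 (fun E' v =>
        [/\ same_but [:: vi; vflag] E E', E' vi <= n
          & map Bit (take (E1 vi) bits) ++ [:: Bit b] ++ v =
            map Bit (take (E' vi) bits)] /\ n - E' vi < n - E1 vi).
    move=> bE E3 same3.
    have i3 : E3 vi = E1 vi by rewrite same3.
    apply: (asg_rule X_ge5) => //=; rewrite i3; first by lia.
    rewrite {2 3 4}/upd /=; split; last by lia.
    split; [|by lia|].
      apply: same_but_upd => // y yv; rewrite same3 ?same2 //.
      by apply: contra yv; rewrite !inE => ->; rewrite orbT.
    rewrite addn1 (take_nth false) ?size_incidence_row // map_rcons -cats1.
    congr (_ ++ [:: Bit _]); rewrite bE -nth_incidence_row /bits.
    by rewrite /E2 /upd /= r1.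
  apply: wp_seq; apply: (if_rule X_ge5) => //; first by lia.
    rewrite tr2 => t1; apply: wp_write; apply: inv; first by rewrite t1.
    exact: same_but_upd.
  move/eqP; rewrite -[_ == 0]negbK tr2 => /negbTE t0.
  apply: wp_write; apply: inv; first by rewrite t0.
  exact: same_but_upd.
- move/eqP; rewrite subn_eq0 => h.
  have -> : E1 vi = size bits by rewrite size_incidence_row; lia.
  by rewrite take_size; apply: post; apply: same_but_upd.
Qed.

Definition kernel_rows := [seq trim G A | A <- s & A \in G].

Lemma wp_write_rows E Q : loaded E ->
  (forall E', same_but [:: vr; vi; vflag] E E' ->
     Q E' (map Bit (flatten (map (@incidence_row n) kernel_rows)))) ->
  wp write_rows E Q.
Proof.
move=> LE post; have Xl := X_large.
pose out t := map Bit (flatten (map (@incidence_row n)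
                [seq trim G A | A <- take t s & A \in G])).
apply: wp_seq; apply: (asg_rule X_ge5) => //.
apply: (while_rule X_ge5 (mu := fun E' => size s - E' vr)
  (Inv := fun E' u => [/\ same_but [:: vr; vi; vflag] E E', E' vr <= size s
                        & u = out (E' vr)])) => //.
  by split; [exact: same_but_upd| |rewrite /out /upd /= take0].
move=> E1 u [same1 in1 ->].
have LE1 := loaded_same (ys := [:: vr; vi; vflag]) isT same1 LE.
have m1 : E1 vm = size s by case: LE1.
rewrite eval_bin [eval_binop _ _ _]/= m1; split; first by lia.
- rewrite -lt0n subn_gt0 => rlt; set E2 := upd _ _ _.
  have same2 : same_but [:: vr; vi; vflag] E E2 by apply: same_but_upd.
  have LE2 : loaded E2 by apply: loaded_upd.
  have r2 : E2 vr = E1 vr by [].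
  have ev := @eval_unhit E2 vr LE2 isT isT rlt.
  have outS : out (E1 vr).+1 = out (E1 vr) ++
      if row (E1 vr) \in G then map Bit (incidence_row (trim G (row (E1 vr))))
      else [::].
    rewrite /out (take_nth set0) // filter_rcons -/(row _).
    case: ifP => _; last by rewrite cats0.
    by rewrite !map_rcons flatten_rcons map_cat.
  have inv v : out (E1 vr).+1 = out (E1 vr) ++ v -> forall E3,
      same_but [:: vi; vflag] E2 E3 ->
      wp (vr ::= Var vr [+] Cst 1) E3 (fun E' v' =>
        [/\ same_but [:: vr; vi; vflag] E E', E' vr <= size s
          & out (E1 vr) ++ v ++ v' = out (E' vr)] /\
        size s - E' vr < size s - E1 vr).
    move=> vE E3 same3.
    have r3 : E3 vr = E1 vr by rewrite same3.
    apply: (asg_rule X_ge5) => //=; rewrite r3; first by lia.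
    rewrite {2 3 4}/upd /=; split; last by lia.
    split; [|by lia|by rewrite cats0 addn1 vE].
    apply: same_but_upd => // y yv; rewrite same3 ?same2 //.
    by apply: contra yv; rewrite !inE => ->; rewrite orbT.
  apply: wp_seq; apply: (if_rule X_ge5) => //.
  + by rewrite ev; apply: leq_trans X_ge5; case: (_ \in _).
  + rewrite ev eqb0 negbK => rG; apply: wp_write_row => //.
    move=> E3 same3; apply: inv; first by rewrite outS rG.
    by move=> y yv; rewrite same3 // /upd; case: eqP yv => // ->.
  + rewrite ev => /eqP; rewrite eqb0 => /negbTE rG.
    apply: (asg_rule X_ge5) => //; apply: inv; first by rewrite outS rG.
    by apply: same_but_upd => //; apply: same_but_upd.
- move/eqP; rewrite subn_eq0 => h.
  have -> : E1 vr = size s by lia.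
  by rewrite /out take_size; apply: post; apply: same_but_upd.
Qed.

(** * Correctness of the answer *)

Definition correct_output (out : seq symbol) :=
  (out = [:: No] /\ ~ yes_instance (HSInstance F k)) \/
  (exists J : hs_instance,
     [/\ encodes J out,
         equivalent (HSInstance F k) J,
         #|hs_family J| <= k ^ 2,
         (forall A, A \in hs_family J -> #|A| <= k ^ 2)
       & linear_family (hs_family J)]).

Lemma linear_unhit : linear_family G.
Proof. by apply: linear_family_sub linF; apply: unhit_sub. Qed.

Lemma correct_no : (kk < #|S|) || (kk ^ 2 < #|G|) -> correct_output [:: No].
Proof.
move=> big; left; split=> // /yes_instanceP[H Hk hit].
case/orP: big; rewrite ltnNge => /negP; apply.
  exact: leq_trans (subset_leq_card (heavy_sub_hitting linF Hk hit)) Hk.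
exact: card_unhit_heavy hit.
Qed.

(** Injectivity of trimming is needed for the encoding: the rows written are then distinct, and
    their number is the announced [#|G|]. Both size bounds are obtained for [kk], which is at most
    [k]. *)
Lemma correct_kernel b0 b1 b2 : #|S| <= kk -> #|G| <= kk ^ 2 ->
  binary_numeral n b0 -> binary_numeral #|G| b1 ->
  binary_numeral (kk - #|S|) b2 ->
  correct_output (map Bit b0 ++ Sep :: map Bit b1 ++ Sep ::
    map Bit (flatten (map (@incidence_row n) kernel_rows)) ++ Sep :: map Bit b2).
Proof.
move=> Sk Gk h0 h1 h2; right.
have kkk : kk ^ 2 <= k ^ 2 by rewrite leq_sqr geq_minl.
have sG : [seq A <- s | A \in G] =i G.
  move=> A; rewrite mem_filter sF; case: (boolP (A \in G)) => //=.
  exact: (subsetP (unhit_sub _ _)).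
have uG : uniq [seq A <- s | A \in G] by apply: filter_uniq.
have szG : size kernel_rows = #|G|.
  by rewrite size_map -(card_uniqP uG); apply: eq_card.
have KF : kernel_family F kk = [set trim G A | A in G] by [].
have kG : #|kernel_family F kk| = #|G|.
  by rewrite KF card_in_imset //; apply: trim_inj; apply: linear_unhit.
exists (HSInstance (kernel_family F kk) (kk - #|S|)); split=> /=.
- exists b0, b1, b2, kernel_rows; split=> //=; first by rewrite szG.
  split.
    rewrite map_inj_in_uniq // => A B; rewrite !sG.
    exact: (trim_inj linear_unhit).
  move=> A; apply/mapP/imsetP => -[C CG ->]; exists C => //.
    by rewrite -sG.
  by rewrite sG.
- rewrite /equivalent yes_instanceP (kernel_equiv linF Sk).
  split=> [[H Hk /hitsP hit]|[H [Hk hit]]]; exists H => //.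
  exact/hitsP.
- by rewrite kG; apply: leq_trans kkk.
- move=> _ /imsetP[A GA ->].
  by apply: leq_trans (card_trim linear_unhit GA) _; apply: leq_trans kkk.
- exact: linear_family_trim linear_unhit.
Qed.

Lemma wp_kernelize E : loaded E ->
  wp kernelize E (fun _ out => correct_output out).
Proof.
move=> LE; have Xl := X_large; have X5 := X_ge5.
have [h0 h1 h2 h3] := LE.
have heavyE : eval E (Sum 12 vn (heavy_expr 12)) = #|S|.
  rewrite eval_sum h0 -sum1_card [RHS]big_mkcond; apply: eq_bigr => i _.
  rewrite (@eval_heavy _ _ i) //.
have Sn : #|S| <= n by rewrite -[X in _ <= X](card_ord n) max_card.
have Gs : #|G| <= size s.
  by rewrite size_rows; apply: subset_leq_card; apply: unhit_sub.
apply: wp_seq; apply: (asg_rule X5) => //; rewrite heavyE; first by lia.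
set E1 := upd E _ _; have LE1 : loaded E1 by apply: loaded_upd.
have rowsE : eval E1 (Sum 13 vm (unhit_expr 13)) = #|G|.
  rewrite eval_sum [E1 vm]h1.
  have -> : #|G| = #|[set A in F | A \in G]|.
    by apply: eq_card => A; rewrite !inE; case: (A \in F).
  rewrite -sum_rows; apply: eq_bigr => r _.
  have rs : upd E1 13 r 13 < size s by rewrite /upd eqxx.
  by rewrite eval_unhit.
apply: wp_seq; apply: (asg_rule X5) => //; rewrite rowsE; first by lia.
set E2 := upd E1 _ _; have LE2 : loaded E2 by apply: loaded_upd.
have k2 : E2 vk = kk by case: LE2.
set test := Bin OpAdd _ _.
have testE : eval E2 test = (kk < #|S|) + (kk ^ 2 < #|G|).
  by rewrite /test eval_bin !lt_exprE eval_bin /= k2 mulnn.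
apply: (if_rule X5) => //; rewrite testE.
- by case: (_ < _); case: (_ < _) => /=; lia.
- rewrite addn_eq0 negb_and !eqb0 !negbK => big; apply: wp_write.
  exact: correct_no.
move/eqP; rewrite addn_eq0 !eqb0 -!leqNgt => /andP[Sk Gk].
set E3 := upd E2 _ _; have LE3 : loaded E3 by apply: loaded_upd.
have n3 : E3 vn = n by case: LE3.
apply: wp_seq; apply: (wp_write_number _ X5) => //; rewrite n3; first by lia.
move=> E4 b0 b0P same4.
apply: wp_seq; apply: wp_write.
have r4 : E4 vrows = #|G| by rewrite same4.
apply: wp_seq; apply: (wp_write_number _ X5) => //; rewrite r4; first by lia.
move=> E5 b1 b1P same5.
have LE5 : loaded E5.
  by apply: loaded_same same5 _ => //; apply: loaded_same same4 _.
apply: wp_seq; apply: wp_write.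
apply: wp_seq; apply: wp_write_rows => // E6 same6.
have k6 : E6 vk = kk by rewrite same6 // same5 // same4.
have s6 : E6 vheavy = #|S| by rewrite same6 // same5 // same4.
apply: wp_seq; apply: wp_write; apply: wp_seq.
apply: (asg_rule X5) => //; rewrite /= k6 s6; first by lia.
apply: (wp_write_number _ X5) => //; rewrite {1}/upd /=; first by lia.
move=> E7 b2 b2P same7.
exact: correct_kernel.
Qed.

(** * Parsing the input *)

(** A numeral ends at a separator or at the end of the input; both have codes of at least 2. *)
Lemma bit_exprE u l t' E t : w = u ++ map Bit l ++ t' ->
  2 <= symbol_code (onth t' 0) -> E vpos = size u + t -> t <= size l ->
  eval E bit_expr = (t < size l).
Proof.
move=> wE end_l posE tl; rewrite lt_exprE /= posE wE.
have [tl'|tl'] := ltnP t (size l); first by rewrite onth_bits //; case: nth.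
have -> : t = size l by lia.
rewrite !onth_cat [_ + _ < _]ltnNge leq_addr /= addKn size_map ltnn subnn.
by rewrite ltnNge end_l.
Qed.

Lemma wp_parse E Q : (forall E', loaded E' -> Q E' [::]) -> wp parse E Q.
Proof.
move=> post; have Xl := X_large; have X5 := X_ge5.
have bnv : bits_value bn = n by case: bnP.
have bmv : bits_value bm = size s by case: bmP.
have bkv : bits_value bk = k by case: bkP.
have [_ bnh] := bnP; have [_ bmh] := bmP; have [_ bkh] := bkP.
have sbn := size_le_bits_value bnh; have sbm := size_le_bits_value bmh.
rewrite bnv in sbn; rewrite bmv in sbm.
have w0 : w = [::] ++ map Bit bn ++
   Sep :: map Bit bm ++ Sep :: map Bit mat ++ Sep :: map Bit bk by [].
have w1 : w = (map Bit bn ++ [:: Sep]) ++ map Bit bm ++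
   Sep :: map Bit mat ++ Sep :: map Bit bk by rewrite /w -!catA.
have w2 : w = (map Bit bn ++ Sep :: map Bit bm ++ Sep :: map Bit mat ++ [:: Sep])
   ++ map Bit bk ++ [::] by rewrite /w cats0 -!catA /= -!catA /= -!catA.
apply: wp_seq; apply: (asg_rule X5) => //.
(* The universe size, and later the number of sets, are read in full, hence the trivial test. *)
apply: wp_seq; apply: (wp_read_number X5 (l := bn) (g := predT)) => //.
- by move=> j jl; rewrite {1}w0 (onth_bits [::]).
- move=> t E' tl _ _ pE; rewrite (bit_exprE w0 _ pE tl) //.
  by rewrite andbT.
- move=> t tl _; have := bits_value_take bn t; rewrite bnv /upd /=; lia.
move=> t E1 tl _ n1 p1 [tE|//]; rewrite tE take_size bnv in n1.
rewrite tE {1}/upd /= add0n in p1 => {t tl tE}.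
apply: wp_seq; apply: (asg_rule X5) => //=; rewrite p1; first by lia.
set E2 := upd E1 _ _.
have s1 : size (map Bit bn ++ [:: Sep]) = E2 vpos.
  by rewrite size_cat size_map.
apply: wp_seq; apply: (wp_read_number X5 (l := bm) (g := predT)) => //.
- by move=> j jl; rewrite {1}w1 -s1 onth_bits.
- move=> t E' tl _ _ pE; rewrite -s1 in pE; rewrite (bit_exprE w1 _ pE tl) //.
  by rewrite andbT.
- move=> t tl _; have := bits_value_take bm t; rewrite bmv /E2 /upd /=; lia.
move=> t E3 tl same3 m3 p3 [tE|//]; rewrite tE take_size bmv in m3.
rewrite tE /E2 {1}/upd /= in p3 => {t tl tE}.
have n3 : E3 vn = n by rewrite same3.
apply: wp_seq; apply: (asg_rule X5) => //=; rewrite p3; first by lia.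
set E4 := upd E3 _ _.
have b4 : E4 vbase = base by rewrite /E4 /upd /= /base; lia.
apply: wp_seq; apply: (asg_rule X5) => //.
  by rewrite /= b4 [E4 _]m3 [E4 _]n3 /base; nia.
set E5 := upd E4 _ _.
have p5 : E5 vpos = base + size s * n + 1.
  by rewrite /E5 {1}/upd /= b4 [E4 _]m3 [E4 _]n3.
have s2 : size (map Bit bn ++ Sep :: map Bit bm ++ Sep :: map Bit mat ++ [:: Sep])
    = E5 vpos.
  rewrite p5 /base !(size_cat, size_map) /= !(size_cat, size_map) /=.
  rewrite !(size_cat, size_map) /= /mat.
  by rewrite (size_flatten_rows _ (@size_incidence_row n)); lia.
apply: wp_seq.
apply: (wp_read_number X5 (l := bk) (g := fun v => v < n)) => //.
- by move=> j jl; rewrite {1}w2 -s2 onth_bits.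
- move=> t E' tl same kE pE; rewrite -s2 in pE.
  rewrite eval_bin (bit_exprE w2 _ pE tl) // lt_exprE /= kE same //.
  by rewrite [E5 vn]n3 mulnb.
- move=> t tl gt; rewrite p5.
  have baseX : base + size s * n + 1 + n <= X by rewrite /base mulnC; lia.
  case: t tl gt => [|t] tl gt; first by rewrite take0; split=> //; lia.
  case: gt => // gt.
  (* The previous prefix had value below [n], hence length below [n]; one more digit keeps the value
     below [2 * n] and the length at most [n]. *)
  have := size_le_bits_value (head_take t bkh); rewrite size_take tl => st.
  rewrite (take_nth false) // bits_value_rcons.
  by move: gt => /= gt; case: (nth _ _ _) => /=; lia.
move=> t E6 tl same6 k6 _ stop.
apply: (asg_rule X5) => //=; have n6 : E6 vn = n by rewrite same6.
  by rewrite n6; lia.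
apply: post; split; rewrite /upd /= ?n6 //; try by rewrite same6.
(* [v - (v - n)] is the minimum of [v] and [n]. If reading stopped early, the prefix and therefore
   [k] are at least [n], so both minima are [n]. *)
rewrite k6 /kk -bkv; case: stop => [->|].
  by rewrite take_size; lia.
by have := bits_value_take bk t; rewrite -leqNgt; lia.
Qed.

Lemma kernel_program_correct : exists out,
  computes_in_space kernel_program
    (space_bound ncells X maxdeg) w out /\ correct_output out.
Proof.
have X5 := X_ge5.
have ok0 : ok ncells X maxdeg (write [::] ncells.-1 0).
  split=> // c; rewrite read_write; case: eqP => // _.
  by rewrite /read nth_nil.
have rep0 : rep nvars ncells X maxdeg (fun _ => 0) (write [::] ncells.-1 0).
  split=> // x xV; rewrite read_write; case: eqP => // _.
  by rewrite /read nth_nil.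
have run : wp (parse ;; kernelize) (fun _ => 0) (fun _ out => correct_output out).
  by apply: wp_seq; apply: wp_parse => E LE; apply: wp_kernelize.
have [M' [E' [out [ex _ co]]]] := run _ rep0.
exists out; split=> //; exists M'.
rewrite -(cat0s out); apply: ExecSeq ex; apply: ExecConst.
exact: ok_space.
Qed.

End Instance.

(** * Logarithmic space *)

(** With [L] the logarithm of [n], a cell takes at most [3 * maxdeg * (L + 4) + 1] bits, which is at
    most [(12 * maxdeg + 1) * (L + 1)]. *)
Lemma space_bound_log n :
  space_bound ncells ((n + 5) ^ 3) maxdeg <=
  ncells * (12 * maxdeg).+1 * (trunc_log 2 n).+1.
Proof.
rewrite /space_bound -mulnA leq_mul2l /= /bit_length -expnM.
set L := trunc_log 2 n.
have nL : n + 5 <= 2 ^ (L + 4).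
  have := trunc_log_ltn n (isT : 1 < 2); rewrite -/L expnS expnD => h.
  by have := expn_gt0 2 L; lia.
have : trunc_log 2 ((n + 5) ^ (3 * maxdeg)) <= (L + 4) * (3 * maxdeg).
  rewrite -(trunc_expnK ((L + 4) * _) (isT : 1 < 2)).
  by apply: leq_trunc_log; rewrite [2 ^ (_ * _)]expnM leq_exp2r.
by lia.
Qed.

Theorem theorem2 :
  exists (p : program) (C : nat),
    forall (n k : nat) (F : {set {set 'I_n}}) (w : seq symbol),
      linear_family F ->
      encodes (HSInstance F k) w ->
      exists out : seq symbol,
        computes_in_space p (C * (trunc_log 2 n).+1) w out /\
        ((out = [:: No] /\ ~ yes_instance (HSInstance F k)) \/
         (exists J : hs_instance,
            [/\ encodes J out,
                equivalent (HSInstance F k) J,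
                #|hs_family J| <= k ^ 2,
                (forall A, A \in hs_family J -> #|A| <= k ^ 2)
              & linear_family (hs_family J)])).
Proof.
exists kernel_program, (ncells * (12 * maxdeg).+1) => n k F w linF.
case=> bn [bm [bk [s [bnP bmP bkP [s_uniq sF] ->]]]].
have [out [[M ex] co]] := kernel_program_correct linF bnP bmP bkP s_uniq sF.
exists out; split=> //; exists M.
exact: exec_mono (space_bound_log n) ex.
Qed.
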